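(* Every $2\times 2$ integer matrix $T$ with characteristic polynomial $\chi(t)=\det(t\cdot I-T)=t^2-1$ is shift equivalent over $\mathbb{Z}$ to either $$P=\begin{pmatrix}0&1\\1&0\end{pmatrix}\quad\text{or}\quad Q=\begin{pmatrix}1&0\\0&-1\end{pmatrix}.$$
   Context: Square integer matrices $T_1$, $T_2$ are shift equivalent over $\mathbb{Z}$ if there are integer matrices $R$, $S$ and a positive integer $m$ with $RT_1=T_2R$, $ST_2=T_1S$, $SR=T_1^m$ and $RS=T_2^m$. *)

(* Defs.v *)
From mathcomp Require Import all_boot all_order all_algebra.
Set Implicit Arguments.
Unset Strict Implicit.
Unset Printing Implicit Defensive.
Import GRing.Theory.
Local Open Scope ring_scope.

Definition shift_equivalent (n1 n2 : nat) (T1 : 'M[int]_n1) (T2 : 'M[int]_n2)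
    : Prop :=
  exists (R : 'M[int]_(n2, n1)) (S : 'M[int]_(n1, n2)) (m : nat),
    [/\ (0 < m)%N,
        R *m T1 = T2 *m R,
        S *m T2 = T1 *m S,
        S *m R = T1 ^+ m
      & R *m S = T2 ^+ m].

Definition mx2 (a b c d : int) : 'M[int]_2 :=
  \matrix_(i < 2, j < 2) (nth [::] [:: [:: a; b]; [:: c; d]] i)`_j.

Definition matP : 'M[int]_2 := mx2 0 1 1 0.

Definition matQ : 'M[int]_2 := mx2 1 0 0 (-1).

(* Main.v *)
(* An eigenvector of T for the eigenvalue 1 can be taken primitive, hence
   extends to a basis (v, w) of Z^2 with T v = v and T w = k v - w.  Replacing
   w by w - j v with j = k %/ 2 gives k = 0 or k = 1.  In the first case (v, w)
   conjugates T to Q, in the second (w, v - w) conjugates T to P.  As all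
   squares are the identity, conjugacy over Z is a shift equivalence with
   m = 2. *)
Require Import Defs.
From mathcomp Require Import all_boot all_order all_algebra.
From mathcomp Require Import ring zify.
Import GRing.Theory.
Local Open Scope ring_scope.

Lemma mx2E (A : 'M[int]_2) : A = mx2 (A 0 0) (A 0 1) (A 1 0) (A 1 1).
Proof.
apply/matrixP=> i j; rewrite mxE.
by case: i j => [[|[|i]] ilt] [[|[|j]] jlt] //=; congr (A _ _); apply: val_inj.
Qed.

Lemma mul_mx2 (a b c d a' b' c' d' : int) :
  mx2 a b c d *m mx2 a' b' c' d' =
  mx2 (a * a' + b * c') (a * b' + b * d') (c * a' + d * c') (c * b' + d * d').
Proof.
apply/matrixP=> i j; rewrite !mxE !big_ord_recl big_ord0 !mxE addr0.
by case: i j => [[|[|i]] ilt] [[|[|j]] jlt].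
Qed.

Lemma mx2_1 : 1%:M = mx2 1 0 0 1.
Proof. by rewrite [LHS]mx2E !mxE. Qed.

Lemma tr_mx2 (a b c d : int) : \tr (mx2 a b c d) = a + d.
Proof. by rewrite /mxtrace !big_ord_recl big_ord0 addr0 !mxE. Qed.

Lemma det_mx2 (a b c d : int) : \det (mx2 a b c d) = a * d - b * c.
Proof.
rewrite (expand_det_row _ 0) !big_ord_recl big_ord0 /cofactor !det_mx11 !mxE /=.
by ring.
Qed.

Lemma shift_equivalent_conj (n : nat) (A B M N : 'M[int]_n) :
    A *m A = 1%:M -> B *m B = 1%:M -> M *m N = 1%:M -> A *m M = M *m B ->
  shift_equivalent A B.
Proof.
move=> AA BB MN AM; have NM := mulmx1C MN.
exists N, M, 2; split=> //; rewrite ?expr2 -?mulmxE ?AA ?BB //.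
(* Intertwining by the inverse: [N A = N A M N = N M B N = B N]. *)
by rewrite -[N *m A]mulmx1 -MN !mulmxA -(mulmxA N) AM mulmxA NM mul1mx.
Qed.

Lemma trace_det_of_char_poly (T : 'M[int]_2) :
  char_poly T = 'X^2 - 1 -> \tr T = 0 /\ \det T = -1.
Proof.
move=> hT; have := char_poly_trace T isT; have := char_poly_det T.
rewrite hT !coefB !coefXn !coef1 /= sqrrN expr1n mul1r !sub0r => <-.
by move=> /eqP; rewrite oppr0 eq_sym oppr_eq0 => /eqP.
Qed.

(** Here [g] is the gcd of [u] and [w]; cancelling it in the Bezout identity gives the last
    equation. *)
Lemma ex_primitive_ray (u w : int) : (u != 0) || (w != 0) ->
  exists g x y p q : int,
    [/\ g != 0, u = g * x, w = g * y & p * x + q * y = 1].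
Proof.
move=> uw0; have g0 : gcdz u w != 0 by rewrite gcdz_eq0 negb_and.
have [p [q pq]] := Bezoutz u w.
have := (dvdzP (dvdz_gcdl u w), dvdzP (dvdz_gcdr u w)).
move: (gcdz u w) g0 pq => g g0 pq [[x xE] [y yE]].
exists g, x, y, p, q; split; rewrite 1?mulrC //.
by apply: (mulfI g0); rewrite mulr1 -[RHS]pq xE yE; ring.
Qed.

Lemma ex_primitive_fixed_vector (a b c : int) : a * a + b * c = 1 ->
  exists x y p q : int,
    [/\ a * x + b * y = x, c * x - a * y = y & p * x + q * y = 1].
Proof.
move=> det1.
(* By [det1], the vector [(b, 1 - a)] is fixed. It vanishes only when [b = 0] and [a = 1], and then
   [(2, c)] is fixed. *)
have [u [w [uw0 eq1 eq2]]] : exists u w : int,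
    [/\ (u != 0) || (w != 0), a * u + b * w = u & c * u - a * w = w].
  have [b0 | b0] := eqVneq b 0; last by exists b, (1 - a); split; lia.
  have [a1 | a1] := eqVneq a 1; first by exists 2, c; split; lia.
  by exists b, (1 - a); split; lia.
have [g [x [y [p [q [g0 uE wE pq1]]]]]] := ex_primitive_ray _ _ uw0.
exists x, y, p, q; split=> //; apply: (mulfI g0).
  by rewrite -uE -[RHS]eq1 uE wE; ring.
by rewrite -wE -[RHS]eq2 uE wE; ring.
Qed.

Lemma ex_triangular_basis (a b c : int) : a * a + b * c = 1 ->
  exists x y z t k : int, [/\ x * t - y * z = 1,
    a * x + b * y = x, c * x - a * y = y,
    a * z + b * t = k * x - z & c * z - a * t = k * y - t].
Proof.
move=> /ex_primitive_fixed_vector[x [y [p [q [fix1 fix2 pq1]]]]].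
(* With [v = (x, y)] and [w = (- q, p)], which have determinant 1, [(r, s)] is [(T + 1) w]. *)
pose r := b * p - (a + 1) * q; pose s := (1 - a) * p - c * q.
(* Since [T] has trace 0, [det(v, (T + 1) w) = det(v - T v, w)], which is 0. So [(r, s)] is parallel
   to [v], and pairing it with [(p, q)] gives the factor [k]. *)
have det0 : x * s = y * r.
  apply/eqP; rewrite -subr_eq0; apply/eqP.
  have -> : x * s - y * r =
    p * (x - (a * x + b * y)) - q * ((c * x - a * y) - y) by rewrite /r /s; ring.
  by rewrite fix1 fix2 !subrr !mulr0 subrr.
exists x, y, (- q), p, (p * r + q * s); split=> //.
- by rewrite -pq1; ring.
- have -> : (p * r + q * s) * x = (p * x + q * y) * r + q * (x * s - y * r).
    by ring.
  by rewrite det0 pq1 /r; ring.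
- have -> : (p * r + q * s) * y = (p * x + q * y) * s - p * (x * s - y * r).
    by ring.
  by rewrite det0 pq1 /s; ring.
Qed.

(** As [T (w - j v) = (k - 2 j) v - (w - j v)], only the parity of [k] matters; a boolean records
    it. *)
Lemma ex_reduced_basis (a b c : int) : a * a + b * c = 1 ->
  exists (x y z t : int) (k : bool), [/\ x * t - y * z = 1,
    a * x + b * y = x, c * x - a * y = y,
    a * z + b * t = k%:R * x - z & c * z - a * t = k%:R * y - t].
Proof.
move=> /ex_triangular_basis[x [y [z [t [k [det1 fix1 fix2 eq1 eq2]]]]]].
have [j [e kE]] : exists (j : int) (e : bool), k = j + j + e%:R.
  by exists (k %/ 2)%Z, (k %% 2 == 1)%Z; case: eqP => /=; lia.
exists x, y, (z - j * x), (t - j * y), e; split=> //.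
- by rewrite -[RHS]det1; ring.
- have -> : a * (z - j * x) + b * (t - j * y) =
    (a * z + b * t) - j * (a * x + b * y) by ring.
  by rewrite eq1 fix1 kE; ring.
- have -> : c * (z - j * x) - a * (t - j * y) =
    (c * z - a * t) - j * (c * x - a * y) by ring.
  by rewrite eq2 fix2 kE; ring.
Qed.

Theorem proposition3p4 (T : 'M[int]_2) (hT : char_poly T = 'X^2 - 1) :
  shift_equivalent T matP \/ shift_equivalent T matQ.
Proof.
have [] := trace_det_of_char_poly _ hT.
rewrite [T]mx2E tr_mx2 det_mx2 {hT}.
move: (T 0 0) (T 0 1) (T 1 0) (T 1 1) => a b c d trT detT.
have {trT} dE : d = - a by lia.
rewrite {}dE in detT *.
have det1 : a * a + b * c = 1 by lia.
have TT : mx2 a b c (- a) *m mx2 a b c (- a) = 1%:M.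
  by rewrite mul_mx2 mx2_1; congr mx2; lia.
have [x [y [z [t [[] [dxy fix1 fix2 eq1 eq2]]]]]] := ex_reduced_basis _ _ _ det1.
  (* For [k = 1], [T] swaps [w] and [v - w], the columns of the first matrix. Its determinant is -1,
     so its inverse is minus its adjugate. *)
  left; apply: (@shift_equivalent_conj _ _ _
    (mx2 z (x - z) t (y - t)) (mx2 (t - y) (x - z) t (- z))) => //.
  - by rewrite /matP mul_mx2 mx2_1.
  - by rewrite mul_mx2 mx2_1; congr mx2; lia.
  - by rewrite /matP !mul_mx2; congr mx2; lia.
(* For [k = 0], the columns are [v] and [w], of determinant 1, and the inverse is the adjugate. *)
right; apply: (@shift_equivalent_conj _ _ _
  (mx2 x z y t) (mx2 t (- z) (- y) x)) => //.
- by rewrite /matQ mul_mx2 mx2_1.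
- by rewrite mul_mx2 mx2_1; congr mx2; lia.
- by rewrite /matQ !mul_mx2; congr mx2; lia.
Qed.
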